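(* Let $g\in\mathbb{N}$ and let $\tau$ be a symmetric complex $g\times g$ matrix with positive definite imaginary part. Consider the Schröter binary relations, for $a_1,a_2,b_1,b_2\in\mathbb{R}^g$ and $u_1,u_2\in\mathbb{C}^g$: $$\theta_{[a_1;b_1]}(u_1|\tau)\,\theta_{[a_2;b_2]}(u_2|\tau)=\sum_{p\in\mathbb{Z}^g/2\mathbb{Z}^g}\theta_{[\frac{a_1+a_2+p}{2};\,b_1+b_2]}(u_1+u_2|2\tau)\,\theta_{[\frac{a_1-a_2+p}{2};\,b_1-b_2]}(u_1-u_2|2\tau).\qquad (S)$$ Then the following hold, where in (i)--(iii) $a_k,b_k\in\mathbb{R}^g$ and $u_k\in\mathbb{C}^g$ ($k=1,2,3,4$) are arbitrary, and $a_k',b_k',u_k'$ are the Whittaker--Watson dual vectors of $(a_1,\dots,a_4)$, $(b_1,\dots,b_4)$, $(u_1,\dots,u_4)$ respectively. (i) As a consequence of (S), the following multidimensional Jacobi identities hold: $$\sum_{q\in\mathbb{Z}^g/2\mathbb{Z}^g}\prod_{k=1}^4 e^{-\pi i\langle a_k,q\rangle}\theta_{[a_k;\,b_k+\frac{q}{2}]}(u_k|\tau)=\sum_{q\in\mathbb{Z}^g/2\mathbb{Z}^g}\prod_{k=1}^4 e^{-\pi i\langle a_k',q\rangle}\theta_{[a_k';\,b_k'+\frac{q}{2}]}(u_k'|\tau).$$ (ii) Similarly, the following Jacobi identities hold: $$\sum_{p\in\mathbb{Z}^g/2\mathbb{Z}^g}\prod_{k=1}^4\theta_{[a_k+\frac{p}{2};\,b_k]}(u_k|\tau)=\sum_{p\in\mathbb{Z}^g/2\mathbb{Z}^g}\prod_{k=1}^4\theta_{[a_k'+\frac{p}{2};\,b_k']}(u_k'|\tau).$$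 (iii) As a consequence of the identities in (i) or of those in (ii), the following multidimensional Riemann identities hold: $$\prod_{k=1}^4\theta_{[a_k';\,b_k']}(u_k'|\tau)=2^{-g}\sum_{p,q\in\mathbb{Z}^g/2\mathbb{Z}^g}e^{-\pi i\langle p,q\rangle}\prod_{k=1}^4 e^{-\pi i\langle a_k,q\rangle}\theta_{[a_k+\frac{p}{2};\,b_k+\frac{q}{2}]}(u_k|\tau).$$ (iv) The identities displayed in (i), (ii) and (iii) (each regarded as a family of identities over all $a_k,b_k,u_k$) are equivalent. (v) Let $\theta(u|\tau)$ be an arbitrary $g$-dimensional odd theta function, and write $\theta(u)=\theta(u|\tau)$. Then, by virtue of (S), the following Weierstrass identity holds for all $w_1,\dots,w_{2^g+2}\in\mathbb{C}^g$: $$\mathrm{Pf}\,\big\|\theta(w_i+w_j)\,\theta(w_i-w_j)\big\|_{i,j=1}^{2^g+2}=0,$$ where $\mathrm{Pf}\,\|a_{i,j}\|$ denotes the Pfaffian of the skew-symmetric matrix $\|a_{i,j}\|$.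
   Context: Let $\langle\cdot,\cdot\rangle:\mathbb{C}^g\times\mathbb{C}^g\to\mathbb{C}$ be the standard bilinear scalar product $\langle x,y\rangle=\sum_j x_jy_j$, and $i=\sqrt{-1}$ in exponents. For a symmetric $g\times g$ matrix $\tau$ with positive definite imaginary part, $a,b\in\mathbb{R}^g$ and $u\in\mathbb{C}^g$, the $g$-dimensional theta function with characteristics $[a;b]$ is $$\theta_{[a;b]}(u|\tau)=\sum_{k\in\mathbb{Z}^g}\exp\{\pi i\langle\tau(k+a),k+a\rangle+2\pi i\langle k+a,u+b\rangle\}.$$ Sums over $\mathbb{Z}^g/2\mathbb{Z}^g$ are taken over any set of representatives, e.g. $\{0,1\}^g$ (the summands do not depend on the choice). Whittaker--Watson dual vectors: for $x_1,x_2,x_3,x_4\in\mathbb{C}^g$, $$x_1'=\tfrac12(-x_1+x_2+x_3+x_4),\quad x_2'=\tfrac12(x_1-x_2+x_3+x_4),$$ $$x_3'=\tfrac12(x_1+x_2-x_3+x_4),\quad x_4'=\tfrac12(x_1+x_2+x_3-x_4).$$ Odd theta functions: characteristics $[a;b]$ all of whose components $a_j,b_j$ are $0$ or $\tfrac12$ are called half-periods. A half-period is even if $4\langle a,b\rangle\equiv 0\pmod 2$ and odd otherwise; the function $u\mapsto\theta_{[a;b]}(u|\tau)$ is even or odd accordingly. A $g$-dimensional odd theta function is $\theta_{[a;b]}(u|\tau)$ with $[a;b]$ an odd half-period. *)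

(* Defs.v *)
From mathcomp Require Import all_boot all_order all_algebra all_fingroup.
From mathcomp Require Import complex.
From mathcomp Require Import all_classical all_reals all_analysis.
From mathcomp Require summability.

Set Implicit Arguments.
Unset Strict Implicit.
Unset Printing Implicit Defensive.

Import Order.TTheory GRing.Theory Num.Theory.
Import numFieldNormedType.Exports.

Local Open Scope ring_scope.
Local Open Scope complex_scope.

Section Vectors.
Variable K : comNzRingType.

(* Bilinear also when K is a field of complex numbers: no conjugation. *)
Definition dotp g (x y : 'cV[K]_g) : K := \sum_j x j 0 * y j 0.

(* 'cV['I_2]_g is the set {0,1}^g of representatives of Z^g / 2 Z^g. *)
Definition repr2 g (p : 'cV['I_2]_g) : 'cV[K]_g := \col_j (p j 0)%:R.

End Vectors.

(* Whittaker-Watson dual; the indices 1, 2, 3, 4 are shifted to 'I_4. *)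
Definition ww_dual (K : fieldType) g (x : 'I_4 -> 'cV[K]_g) (k : 'I_4) :
    'cV[K]_g :=
  2^-1 *: \sum_(l < 4) (-1) ^+ (l == k) *: x l.

(* In even size m, the factors are A (s 0) (s 1), A (s 2) (s 3), ...: ordS is
   the cyclic successor, which does not wrap around at an even index i < m. *)
Definition pfaffian (K : fieldType) m (A : 'M[K]_m) : K :=
  if odd m then 0 else
  (2 ^+ m./2 * (m./2)`!%:R)^-1 *
  \sum_(s : 'S_m) (-1) ^+ s * \prod_(i < m | ~~ odd i) A (s i) (s (ordS i)).

Section Theta.
Variables (R : realType) (g : nat).
Local Notation C := R[i].

Definition cexp (z : C) : C :=
  (expR (complex.Re z))%:C * (cos (complex.Im z) +i* sin (complex.Im z)).

(* pi * i *)
Definition pii : C := (pi : R) *i.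

Definition cplx (x : 'cV[R]_g) : 'cV[C]_g := map_mx (real_complex R) x.

(* Symmetric matrices with positive definite imaginary part. *)
Definition siegel (tau : 'M[C]_g) : Prop :=
  tau^T = tau /\
  forall x : 'cV[R]_g, x != 0 ->
    0 < dotp (map_mx (@complex.Im R) tau *m x) x.

Definition theta_term (tau : 'M[C]_g) (a b : 'cV[R]_g) (u : 'cV[C]_g)
    (k : 'cV[int]_g) : C :=
  let x := cplx (map_mx intr k + a) in
  cexp (pii * dotp (tau *m x) x + 2 * pii * dotp x (u + cplx b)).

(* Unordered sum over Z^g: the limit of the finite partial sums along the
   directed set of finite subsets of Z^g. *)
Definition theta (tau : 'M[C]_g) (a b : 'cV[R]_g) (u : 'cV[C]_g) : C :=
  summability.sum (theta_term tau a b u : 'cV[int]_g -> C^o).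

Definition schroter (tau : 'M[C]_g) : Prop :=
  forall (a1 a2 b1 b2 : 'cV[R]_g) (u1 u2 : 'cV[C]_g),
    theta tau a1 b1 u1 * theta tau a2 b2 u2 =
    \sum_(p : 'cV['I_2]_g)
      theta (2 *: tau) (2^-1 *: (a1 + a2 + repr2 R p)) (b1 + b2) (u1 + u2) *
      theta (2 *: tau) (2^-1 *: (a1 - a2 + repr2 R p)) (b1 - b2) (u1 - u2).

Definition jacobi_b (tau : 'M[C]_g) : Prop :=
  forall (a b : 'I_4 -> 'cV[R]_g) (u : 'I_4 -> 'cV[C]_g),
    let lhs a b u := \sum_(q : 'cV['I_2]_g) \prod_(k < 4)
      (cexp (- pii * (dotp (a k) (repr2 R q))%:C) *
       theta tau (a k) (b k + 2^-1 *: repr2 R q) (u k)) in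
    lhs a b u = lhs (ww_dual a) (ww_dual b) (ww_dual u).

Definition jacobi_a (tau : 'M[C]_g) : Prop :=
  forall (a b : 'I_4 -> 'cV[R]_g) (u : 'I_4 -> 'cV[C]_g),
    let lhs a b u := \sum_(p : 'cV['I_2]_g) \prod_(k < 4)
      theta tau (a k + 2^-1 *: repr2 R p) (b k) (u k) in
    lhs a b u = lhs (ww_dual a) (ww_dual b) (ww_dual u).

Definition riemann (tau : 'M[C]_g) : Prop :=
  forall (a b : 'I_4 -> 'cV[R]_g) (u : 'I_4 -> 'cV[C]_g),
    \prod_(k < 4) theta tau (ww_dual a k) (ww_dual b k) (ww_dual u k) =
    (2 ^+ g)^-1 *
    \sum_(p : 'cV['I_2]_g) \sum_(q : 'cV['I_2]_g)
      cexp (- pii * dotp (repr2 C p) (repr2 C q)) *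
      \prod_(k < 4)
        (cexp (- pii * (dotp (a k) (repr2 R q))%:C) *
         theta tau (a k + 2^-1 *: repr2 R p) (b k + 2^-1 *: repr2 R q) (u k)).

Definition half_period (a b : 'cV[R]_g) : Prop :=
  forall j, a j 0 \in [:: 0; 2^-1] /\ b j 0 \in [:: 0; 2^-1].

(* 4 <a, b> = 0 mod 2 *)
Definition even_char (a b : 'cV[R]_g) : Prop :=
  exists m : int, 4 * dotp a b = 2 * m%:~R.

Definition odd_half_period (a b : 'cV[R]_g) : Prop :=
  half_period a b /\ ~ even_char a b.

Definition weierstrass (f : 'cV[C]_g -> C) : Prop :=
  forall w : 'I_(2 ^ g + 2) -> 'cV[C]_g,
    pfaffian (\matrix_(i, j) (f (w i + w j) * f (w i - w j))) = 0.

End Theta.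

(* Main.v *)
(* The theta series converges absolutely because the imaginary part of tau is
   coercive, so a product of two theta functions is a sum over pairs (k, l) of
   lattice points. Every such pair is uniquely (m + n + p, m - n) with p in
   {0,1}^g, and substituting this gives (S). Applying (S) to the pairs (1,2) and
   (3,4) turns either side of a Jacobi identity into a sum over half-lattice
   classes; Whittaker-Watson duality exchanges x_1 + x_2 with x_3 + x_4 and negates
   x_1 - x_2 and x_3 - x_4, which leaves that sum invariant. Riemann's identity is
   the Fourier inversion of Jacobi's over (Z/2)^g. Since all the identities hold,
   the remaining implications in (iii) and (iv) are immediate. Finally, (S) factors
   the matrix of the Weierstrass identity through a space of dimension 2^g; a skew
   matrix of size 2^g + 2 and smaller rank is singular, and a kernel vector forces
   its Pfaffian to vanish. *)

Require Import Defs.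
From mathcomp Require Import all_boot all_order all_algebra.
From mathcomp Require Import fingroup perm finmap complex.
From mathcomp Require Import all_classical all_reals all_analysis.
From mathcomp Require summability.
From mathcomp Require Import ring lra zify.

Set Implicit Arguments.
Unset Strict Implicit.
Unset Printing Implicit Defensive.

Import Order.TTheory GRing.Theory Num.Theory.
Import numFieldNormedType.Exports ComplexField.Normc.

Local Open Scope ring_scope.
Local Open Scope complex_scope.

(** * Unordered sums of complex families and absolute convergence *)

Section UnorderedSums.
Variable R : realType.
Local Notation C := R[i].
Local Open Scope fset_scope.
Local Open Scope ring_scope.

(** The epsilon form, with modulus in [R], of the limit defining [summability.sum]. As a relation it
    also asserts convergence, which the bare value of that limit does not. *)
Definition has_sum (I : choiceType) (x : I -> C) (l : C) : Prop :=
  forall e : R, 0 < e -> exists A0 : {fset I}, forall A : {fset I},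
    A0 `<=` A -> normc (\sum_(i <- A) x i - l) < e.

Definition abs_bounded (I : choiceType) (x : I -> C) : Prop :=
  exists M : R, forall s : seq I, uniq s -> \sum_(i <- s) normc (x i) <= M.

Lemma normCE (z : C) : `|z| = (normc z)%:C.
Proof. by []. Qed.

Lemma normc_ge0 (z : C) : 0 <= normc z.
Proof. by rewrite -ler0c -normCE. Qed.

Lemma normc_lt_eq0 (z : C) : (forall e : R, 0 < e -> normc z < e) -> z = 0.
Proof.
move=> h; apply: eq0_normc; apply/eqP; rewrite eq_le normc_ge0 andbT leNgt.
by apply/negP => /h; rewrite ltxx.
Qed.

Lemma has_sum_cvg (I : choiceType) (x : I -> C^o) (l : C^o) :
  has_sum x l -> (summability.partial_sum x @ summability.totally --> l)%classic.
Proof.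
move=> h; have Ft := @summability.totally_filter I.
apply/cvgrPdist_lt => e e0.
have eR : e = (complex.Re e)%:C by rewrite RRe_real // gtr0_real.
have : 0 < complex.Re e by rewrite -ltcR -eR.
move=> /h[A0 hA0]; exists A0 => // A /= /hA0.
rewrite /summability.partial_sum -(big_seq_fsetE _ A xpredT x) /= => hl.
by rewrite distrC normCE eR ltcR.
Qed.

Lemma eq_has_sum (I : choiceType) (x y : I -> C) (l : C) :
  x =1 y -> has_sum x l -> has_sum y l.
Proof. by move=> /funext ->. Qed.

Lemma has_sumE (I : choiceType) (x : I -> C) (l : C) :
  has_sum x l -> summability.sum (x : I -> C^o) = l.
Proof.
move=> /has_sum_cvg h; have Ft := @summability.totally_filter I.
apply: cvg_lim; first exact: norm_hausdorff.
exact: h.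
Qed.

Lemma has_sum_unique (I : choiceType) (x : I -> C) (l m : C) :
  has_sum x l -> has_sum x m -> l = m.
Proof. by move=> /has_sumE <- /has_sumE <-. Qed.

Lemma has_sumD (I : choiceType) (x y : I -> C) (l m : C) :
  has_sum x l -> has_sum y m -> has_sum (fun i => x i + y i) (l + m).
Proof.
move=> hx hy e e0; have e20 : 0 < e / 2 by lra.
have [A hA] := hx _ e20; have [B hB] := hy _ e20.
exists (A `|` B) => D; rewrite fsubUset => /andP[/hA h1 /hB h2].
rewrite big_split /= opprD addrACA.
by apply: le_lt_trans (le_normcD _ _) _; lra.
Qed.

Lemma has_sumZ (I : choiceType) (x : I -> C) (l c : C) :
  has_sum x l -> has_sum (fun i => c * x i) (c * l).
Proof.
move=> hx e e0; have c0 := normc_ge0 c.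
have h0 : 0 < e / (normc c + 1) by rewrite divr_gt0 //; lra.
have [A hA] := hx _ h0; exists A => B /hA.
rewrite -big_distrr /= -mulrBr normcM => hB.
apply: (@le_lt_trans _ _ (normc c * (e / (normc c + 1)))).
  by rewrite ler_wpM2l // ltW.
by rewrite mulrA ltr_pdivrMr; nra.
Qed.

Lemma has_sum0 (I : choiceType) : has_sum (fun _ : I => 0) 0.
Proof.
by move=> e e0; exists fset0 => A _; rewrite big1 // subrr normc0.
Qed.

Lemma has_sum_big (I : choiceType) (J : Type) (s : seq J) (x : J -> I -> C)
    (l : J -> C) :
  (forall j, has_sum (x j) (l j)) ->
  has_sum (fun i => \sum_(j <- s) x j i) (\sum_(j <- s) l j).
Proof.
move=> h; elim: s => [|j s ih].
  by under eq_fun do rewrite big_nil; rewrite big_nil; exact: has_sum0.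
by under eq_fun do rewrite big_cons; rewrite big_cons; exact: has_sumD.
Qed.

Lemma has_sum_reindex (I J : choiceType) (h : J -> I) (x : I -> C) (l : C) :
  bijective h -> has_sum x l -> has_sum (x \o h) l.
Proof.
move=> [g hK gK] hx e /hx[A0 hA0]; exists (g @` A0) => B sB.
have := hA0 (h @` B); rewrite big_imfset /=; last by move=> ? ? _ _ /(can_inj hK).
apply; apply/fsubsetP => i iA; rewrite -(gK i); apply: in_imfset => /=.
by apply: (fsubsetP sB); apply: in_imfset.
Qed.

Lemma has_sum_fin (I : finType) (x : I -> C) (l : C) :
  has_sum x l -> l = \sum_i x i.
Proof.
move=> hx; apply/eqP; rewrite eq_sym -subr_eq0; apply/eqP/normc_lt_eq0 => e.
move=> /hx[A0 /(_ [fset i | i in I])]; rewrite big_imfset //= big_enum /=; apply.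
by apply/fsubsetP => i _; rewrite !inE.
Qed.

(** Over a large finite box the sum of [x] is close to [S] and, once the box is long enough in its
    second direction, also close to the sum of [l] over its first side. *)
Lemma has_sum_fubini (J I : choiceType) (x : J * I -> C) (l : J -> C) (S : C) :
  has_sum x S -> (forall j, has_sum (fun i => x (j, i)) (l j)) -> has_sum l S.
Proof.
move=> hx hl e e0; have e20 : 0 < e / 2 by lra.
have [A0 hA0] := hx _ e20.
exists [fset u.1 | u in A0] => B sB.
have [D0 hD0] := has_sum_big (enum_fset B) hl e20.
(* [D] is large enough for all the rows in [B] at once, and contains the second coordinates of [A0],
   so that the box contains [A0]. *)
pose D := D0 `|` [fset u.2 | u in A0].
have := hD0 D (fsubsetUl _ _); have := hA0 (B `*` D).
have -> : \sum_(u <- B `*` D) x u = \sum_(i <- D) \sum_(j <- B) x (j, i).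
  rewrite exchange_big /= /fsetM big_imfset2 //=.
  by move=> [a b] [a' b'] _ _ /= [-> ->].
set s1 := \sum_(i <- D) _; set s2 := \sum_(i <- B) _.
move=> h1 h2; rewrite (_ : s2 - S = - (s1 - s2) + (s1 - S)); last by ring.
apply: le_lt_trans (le_normcD _ _) _; rewrite normcN.
suff : normc (s1 - S) < e / 2 by lra.
apply: h1; apply/fsubsetP => -[j i] ji; rewrite in_fsetM /=; apply/andP; split.
  by apply: (fsubsetP sB); exact: (in_imfset _ (fun u => u.1) ji).
by rewrite in_fsetU; apply/orP; right; exact: (in_imfset _ (fun u => u.2) ji).
Qed.

Lemma ler_sum_subset (I : eqType) (F : I -> R) (s t : seq I) :
  (forall i, 0 <= F i) -> uniq s -> {subset s <= t} ->
  \sum_(i <- s) F i <= \sum_(i <- t) F i.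
Proof.
move=> F0; elim: s t => [|i s ih] t /=.
  by move=> _ _; rewrite big_nil sumr_ge0.
move=> /andP[nis us] st.
have it : i \in t by apply: st; rewrite mem_head.
rewrite big_cons (perm_big _ (perm_to_rem it)) big_cons /= lerD2l.
apply: ih => // j js; have /st jt : j \in i :: s by rewrite inE js orbT.
have ij : j != i by apply: contraNneq nis => <-.
by have := perm_mem (perm_to_rem it) j; rewrite jt inE (negbTE ij).
Qed.

(** A finite set of pairs lies in the product of its two projections, where the sum of moduli
    factors. *)
Lemma abs_bounded_prod (I J : choiceType) (x : I -> C) (y : J -> C) :
  abs_bounded x -> abs_bounded y -> abs_bounded (fun u => x u.1 * y u.2).
Proof.
move=> [M hM] [N hN]; exists (M * N) => s us.
set s1 := undup (map fst s); set s2 := undup (map snd s).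
have u1 : uniq s1 := undup_uniq _; have u2 : uniq s2 := undup_uniq _.
apply: (@le_trans _ _ (\sum_(u <- [seq (i, j) | i <- s1, j <- s2])
    normc (x u.1 * y u.2))).
  apply: ler_sum_subset => // [u|[i j] ij]; first exact: normc_ge0.
  by apply: allpairs_f; rewrite mem_undup;
    [exact: (map_f fst ij) | exact: (map_f snd ij)].
rewrite big_allpairs_dep /=.
under eq_bigr => i _ do under eq_bigr => j _ do rewrite normcM.
under eq_bigr => i _ do rewrite -big_distrr /=.
rewrite -big_distrl /= ler_pM ?sumr_ge0 //; try by move=> *; exact: normc_ge0.
- exact: hM.
- exact: hN.
Qed.

(** The supremum of the finite partial sums is the limit, because these grow with the finite set. *)
Lemma has_sum_nneg (I : choiceType) (r : I -> R) (M : R) :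
  (forall i, 0 <= r i) -> (forall s, uniq s -> \sum_(i <- s) r i <= M) ->
  exists l : R, has_sum (fun i => (r i)%:C) l%:C.
Proof.
move=> r0 hM.
pose E := [set (\sum_(i <- A) r i) | A in [set: {fset I}]]%classic.
have supE : has_sup E.
  split; first by exists (\sum_(i <- fset0 : {fset I}) r i), fset0.
  by exists M => _ [A _ <-]; apply: hM.
exists (sup E) => e e0.
have [_ [A0 _ <-] hA0] := sup_adherent e0 supE.
exists A0 => A sA; rewrite -rmorph_sum -rmorphB /=.
rewrite expr0n addr0 sqrtr_sqr ler0_norm; last first.
  by rewrite subr_le0; apply: ub_le_sup; [case: supE|exists A].
suff : \sum_(i <- A0) r i <= \sum_(i <- A) r i by lra.
by apply: ler_sum_subset => //; apply/fsubsetP.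
Qed.

Lemma Re_le_normc (z : C) : `|complex.Re z| <= normc z.
Proof. by rewrite -lecR -normCE normc_ge_Re. Qed.

Lemma Im_le_normc (z : C) : `|complex.Im z| <= normc z.
Proof.
by case: z => a b /=; rewrite -sqrtr_sqr ler_wsqrtr // lerDr sqr_ge0.
Qed.

(** A real family f dominated by |x| is the difference of the nonnegative families |x| + f and |x|.
    This applies to the real and the imaginary part. *)
Lemma abs_bounded_has_sum (I : choiceType) (x : I -> C) :
  abs_bounded x -> exists l, has_sum x l.
Proof.
move=> [M hM].
have [n hn] := has_sum_nneg (fun i => normc_ge0 (x i)) hM.
have real_sum (f : I -> R) : (forall i, `|f i| <= normc (x i)) ->
    exists l : C, has_sum (fun i => (f i)%:C) l.
  move=> hf; have [i|s us|l hl] :=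
    @has_sum_nneg I (fun i => normc (x i) + f i) (M + M).
  - by have := ler_normlW (le_trans (lexx `|- f i|) _); rewrite normrN;
      move=> /(_ _ (hf i)); lra.
  - rewrite big_split /= lerD ?hM //; apply: le_trans (hM s us).
    by apply: ler_sum => i _; apply: le_trans (hf i); exact: ler_norm.
  exists (l%:C + (-1) * n%:C); have := has_sumD hl (has_sumZ (-1) hn).
  by under eq_fun do rewrite mulN1r -rmorphN -rmorphD /= addrC addKr.
have [a ha] := real_sum _ (fun i => Re_le_normc (x i)).
have [b hb] := real_sum _ (fun i => Im_le_normc (x i)).
exists (a + 'i%C * b); have := has_sumD ha (has_sumZ 'i%C hb).
by under eq_fun do rewrite -complexE.
Qed.

(** Absolute boundedness gives some sum over the pairs; summing by rows identifies it with the
    product. *)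
Lemma has_sum_prod (I J : choiceType) (x : I -> C) (y : J -> C) (l m : C) :
  abs_bounded x -> abs_bounded y -> has_sum x l -> has_sum y m ->
  has_sum (fun u => x u.1 * y u.2) (l * m).
Proof.
move=> bx bdy hx hy.
have [S hS] := abs_bounded_has_sum (abs_bounded_prod bx bdy).
have hS' : has_sum (fun i => x i * m) S.
  by apply: (has_sum_fubini hS) => i /=; exact: has_sumZ.
suff hlm : has_sum (fun i => x i * m) (l * m) by rewrite (has_sum_unique hlm hS').
by under eq_fun do rewrite mulrC; rewrite mulrC; exact: has_sumZ.
Qed.

End UnorderedSums.

(** * Bilinearity of the scalar product *)

Section Dotp.
Variables (K : comNzRingType) (g : nat).
Implicit Types x y z : 'cV[K]_g.

Lemma dotpC x y : dotp x y = dotp y x.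
Proof. by apply: eq_bigr => j _; rewrite mulrC. Qed.

Lemma dotpDl x y z : dotp (x + y) z = dotp x z + dotp y z.
Proof. by rewrite -big_split; apply: eq_bigr => j _; rewrite mxE mulrDl. Qed.

Lemma dotpDr x y z : dotp x (y + z) = dotp x y + dotp x z.
Proof. by rewrite dotpC dotpDl !(dotpC x). Qed.

Lemma dotpZl c x y : dotp (c *: x) y = c * dotp x y.
Proof. by rewrite big_distrr; apply: eq_bigr => j _; rewrite mxE /= mulrA. Qed.

Lemma dotpZr c x y : dotp x (c *: y) = c * dotp x y.
Proof. by rewrite dotpC dotpZl dotpC. Qed.

Lemma dotpNl x y : dotp (- x) y = - dotp x y.
Proof. by rewrite -scaleN1r dotpZl mulN1r. Qed.

Lemma dotpNr x y : dotp x (- y) = - dotp x y.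
Proof. by rewrite dotpC dotpNl dotpC. Qed.

Lemma dotp0r x : dotp x 0 = 0.
Proof. by rewrite -(scale0r 0) dotpZr mul0r. Qed.

End Dotp.

Lemma dotp_map (K L : comNzRingType) (f : {rmorphism K -> L}) g
    (x y : 'cV[K]_g) :
  dotp (map_mx f x) (map_mx f y) = f (dotp x y).
Proof. by rewrite rmorph_sum; apply: eq_bigr => j _; rewrite !mxE rmorphM. Qed.

(** * The complex exponential and its values at integer multiples of pi i *)

Section ComplexExponential.
Variable R : realType.
Local Notation C := R[i].
Implicit Types z w : C.

Lemma cexpD z w : cexp (z + w) = cexp z * cexp w.
Proof.
case: z w => [a b] [c d]; rewrite /cexp /= expRD cosD sinD rmorphM /=.
rewrite mulrACA; congr (_ * _); rewrite -[RHS]/(Complex _ _).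
by congr Complex; ring.
Qed.

Lemma cexp0 : cexp (0 : C) = 1.
Proof. by rewrite /cexp /= expR0 cos0 sin0 mul1r. Qed.

Lemma cexpNK z : cexp (- z) * cexp z = 1.
Proof. by rewrite -cexpD addNr cexp0. Qed.

Lemma cexp_sum (I : Type) (s : seq I) (F : I -> C) :
  cexp (\sum_(i <- s) F i) = \prod_(i <- s) cexp (F i).
Proof. by rewrite (big_morph (@cexp R) cexpD cexp0). Qed.

Lemma normc_cexp z : normc (cexp z) = expR (complex.Re z).
Proof.
rewrite /cexp normcM /= cos2Dsin2 sqrtr1 mulr1 expr0n addr0 sqrtr_sqr.
by rewrite ger0_norm // expR_ge0.
Qed.

Lemma cexp_pii : cexp (pii R) = -1.
Proof.
rewrite /cexp /pii /= expR0 cospi sinpi mul1r.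
by apply/eqP; rewrite eq_complex /= oppr0 !eqxx.
Qed.

Lemma cexp_pii_nat (n : nat) : cexp (pii R * n%:R) = (-1) ^+ n.
Proof.
elim: n => [|n ih]; first by rewrite mulr0 cexp0.
by rewrite -addn1 natrD mulrDr mulr1 cexpD ih cexp_pii exprD expr1.
Qed.

Lemma cexp_pii_int (n : int) : cexp (pii R * n%:~R) = (-1) ^+ `|n|%N.
Proof.
case: n => n; first exact: cexp_pii_nat.
rewrite NegzE mulrNz mulrN abszN /= -cexp_pii_nat.
(* A sign is its own inverse, which settles the negative integers. *)
have h : cexp (pii R * n.+1%:R) ^+ 2 = 1.
  by rewrite cexp_pii_nat -exprM muln2 -signr_odd odd_double.
transitivity (cexp (- (pii R * n.+1%:R)) * cexp (pii R * n.+1%:R) ^+ 2).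
  by rewrite h mulr1.
by rewrite expr2 mulrA cexpNK mul1r.
Qed.

Lemma cexp_2pii_int (n : int) : cexp (2 * pii R * n%:~R) = 1.
Proof.
rewrite -mulrA mulr_natl mulr2n cexpD cexp_pii_int -expr2 -exprM.
by rewrite muln2 -signr_odd odd_double.
Qed.

End ComplexExponential.

(** * Coercivity of positive definite forms *)

Section Convergence.
Variable R : realType.

(** The constant is the minimum of the form on the unit sphere, attained by compactness; homogeneity
    extends the bound to all vectors. *)
Lemma posdef_coercive g (Y : 'M[R]_g) :
  (forall x : 'cV[R]_g, x != 0 -> 0 < dotp (Y *m x) x) ->
  exists2 c : R, 0 < c & forall x : 'cV[R]_g, c * dotp x x <= dotp (Y *m x) x.
Proof.
move=> hY.
have dotp_ge0 (x : 'cV[R]_g) : 0 <= dotp x x.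
  by apply: sumr_ge0 => j _; rewrite -expr2 sqr_ge0.
have dotp_eq0 (x : 'cV[R]_g) : dotp x x = 0 -> x = 0.
  move=> /eqP; rewrite psumr_eq0 => [/allP h|j _]; last by rewrite -expr2 sqr_ge0.
  apply/matrixP => i j; rewrite (ord1 j) mxE; apply/eqP.
  by have := h i (mem_index_enum _); rewrite -expr2 sqrf_eq0.
(* The extreme value theorem applied below is about row vectors, hence the transposes. *)
pose f (x : 'rV[R]_g) := dotp (Y *m x^T) x^T.
pose N (x : 'rV[R]_g) := dotp x^T x^T.
pose A := [set x | N x = 1]%classic.
have coord (j : 'I_g) (x : 'rV[R]_g) :
  ((fun v : 'rV[R]_g => v 0 j) y @[y --> x] --> x 0 j)%classic.
  exact: coord_continuous.
have cN : continuous N.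
  have -> : N = fun x => \sum_j x 0 j * x 0 j.
    by apply/funext => x; apply: eq_bigr => j _; rewrite !mxE.
  apply: continuous_big => [|j _ x]; first exact: add_continuous.
  exact: (cvgM (coord j x) (coord j x)).
have cf : continuous f.
  have -> : f = fun x => \sum_j (\sum_k Y j k * x 0 k) * x 0 j.
    apply/funext => x; apply: eq_bigr => j _; rewrite !mxE; congr (_ * _).
    by apply: eq_bigr => k _; rewrite !mxE.
  apply: continuous_big => [|j _ x]; first exact: add_continuous.
  suff h : continuous (fun x : 'rV[R]_g => \sum_k Y j k * x 0 k).
    exact: (cvgM (h x) (coord j x)).
  apply: continuous_big => [|k _ z]; first exact: add_continuous.
  exact: (cvgM (cvg_cst (Y j k)) (coord k z)).
have cA : compact A.
  apply: bounded_closed_compact.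
    exists 1; split=> // M M1 x /= Nx; apply: ltW; apply: le_lt_trans M1.
    rewrite [leLHS]/Num.norm /= mx_normrE; apply: bigmax_le => // -[i j] _ /=.
    rewrite (ord1 i) -ler_sqr ?nnegrE // expr1n real_normK ?num_real // -Nx.
    rewrite /N /dotp (bigD1 j) //= mxE expr2 lerDl sumr_ge0 // => k _.
    by rewrite -expr2 sqr_ge0.
  exact: preimage_closed (fun x _ => cN x) (@closed_eq R 1).
have [[x Ax]|noA] := pselect (A !=set0)%classic; last first.
  (* With an empty unit sphere every vector is zero, since a nonzero one could be normalized; any
     positive constant then serves. *)
  exists 1 => // x; have [->|x0] := eqVneq x 0.
    by rewrite mulmx0 /dotp !big1 ?mulr0 // => j _; rewrite mxE mulr0.
  case: noA; exists ((Num.sqrt (dotp x x))^-1 *: x^T).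
  rewrite /A /N /= linearZ /= trmxK dotpZl dotpZr mulrA -expr2 exprVn sqr_sqrtr //.
  by rewrite mulVf //; apply: contraNneq x0 => /dotp_eq0 ->.
have [|c Ac minc] := @EVT_min_rV R g f A _ cA (continuous_subspaceT cf).
  by exists x.
have c0 : c^T != 0.
  apply/eqP => c0; move: Ac; rewrite inE /A /N /= c0 /dotp big1.
    by move=> /esym/eqP; rewrite oner_eq0.
  by move=> j _; rewrite mxE mulr0.
exists (f c); first exact: hY.
move=> y; have [->|y0] := eqVneq y 0.
  by rewrite mulmx0 /dotp !big1 ?mulr0 // => j _; rewrite mxE mulr0.
have d0 : 0 < dotp y y.
  by rewrite lt_def dotp_ge0 andbT; apply: contraNneq y0 => /dotp_eq0 ->.
set s := (Num.sqrt (dotp y y))^-1.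
have s2 : s ^+ 2 = (dotp y y)^-1 by rewrite exprVn sqr_sqrtr.
have := minc (s *: y^T); rewrite inE /A /N /f /= linearZ /= trmxK.
rewrite -scalemxAr !dotpZl !dotpZr !mulrA -expr2 s2 mulVf ?gt_eqF // => /(_ erefl).
by rewrite ler_pdivlMl // mulrC.
Qed.

End Convergence.

(** * Absolute convergence of the theta series *)

Section ThetaConvergence.
Variable R : realType.
Local Notation C := R[i].

Lemma geometric_sum_le (q : R) n :
  0 <= q -> q < 1 -> \sum_(t < n) q ^+ t <= (1 - q)^-1.
Proof.
move=> q0 q1; rewrite -[leRHS]mulr1 ler_pdivlMl ?subr_gt0 //.
by rewrite -opprB mulNr -subrX1 opprB gerBl exprn_ge0.
Qed.

(* The lattice box [-N, N)^g is enumerated by finite functions into 'I_N + 'I_N,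
   the two summands being the nonnegative and the negative integers. *)
Lemma lattice_exp_sum_bounded g (K : 'I_g -> R) :
  exists M : R, forall s : seq 'cV[int]_g, uniq s ->
    \sum_(k <- s) \prod_j expR (K j - (absz (k j 0))%:R) <= M.
Proof.
pose q : R := expR (-1).
have q0 : 0 <= q := expR_ge0 _.
have q1 : q < 1 by rewrite expR_lt1; lra.
have qE n : expR (- n%:R) = q ^+ n :> R by rewrite -expRM_natl mulrN1.
pose z N (u : 'I_N + 'I_N) : int :=
  match u with inl t => Posz t | inr t => Negz t end.
(* Each coordinate contributes two geometric series of ratio 1/e, one for each sign. *)
exists (\prod_j (expR (K j) * (2 * (1 - q)^-1))) => s us.
pose N := (\max_(k <- s) \max_j absz (k j 0%R)).+1.
have sN k j : k \in s -> (absz (k j 0%R) < N)%N.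
  move=> ks; rewrite ltnS; apply: leq_trans (leq_bigmax_seq _ ks isT).
  exact: (leq_bigmax j).
pose v (f : {ffun 'I_g -> 'I_N + 'I_N}) : 'cV[int]_g := \col_j z N (f j).
apply: (@le_trans _ _ (\sum_(k <- [seq v f | f : {ffun 'I_g -> 'I_N + 'I_N}])
    \prod_j expR (K j - (absz (k j 0))%:R))).
  apply: ler_sum_subset => // [k|k ks]; first by rewrite prodr_ge0.
  pose w (j : 'I_g) : 'I_N + 'I_N :=
    match k j 0 with Posz t => inl (inord t) | Negz t => inr (inord t) end.
  apply/mapP; exists (finfun w); rewrite ?mem_enum //.
  apply/colP => j; rewrite mxE ffunE /w; have := sN k j ks.
  case: (k j 0) => t /= tN; rewrite inordK //.
  exact: ltn_trans tN.
rewrite big_map big_enum /=.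
under eq_bigr => f _ do under eq_bigr => j _ do rewrite mxE.
(* The sum over the box factors into a product of one-dimensional sums. *)
rewrite -(bigA_distr_bigA (fun j u => expR (K j - `|z N u|%N%:R))) /=.
apply: ler_prod => j _; apply/andP; split.
  by apply: sumr_ge0 => u _; exact: expR_ge0.
under eq_bigr => u _ do rewrite expRD qE.
rewrite -big_distrr /= ler_wpM2l ?expR_ge0 // big_sumType /=.
have h := geometric_sum_le N q0 q1.
rewrite mulr_natl mulr2n; apply: lerD => //.
(* [Negz t] has absolute value t + 1, so the negative half carries an extra factor q <= 1. *)
apply: le_trans h; apply: ler_sum => t _.
by rewrite exprS ger_pMl ?ltW // exprn_gt0 // expR_gt0.
Qed.

Lemma ImD (x y : C) : complex.Im (x + y) = complex.Im x + complex.Im y.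
Proof. by case: x y => [? ?] []. Qed.

Lemma ReD (x y : C) : complex.Re (x + y) = complex.Re x + complex.Re y.
Proof. by case: x y => [? ?] []. Qed.

Lemma ImMreal (x : C) (r : R) : complex.Im (x * r%:C) = complex.Im x * r.
Proof. by case: x => a b /=; rewrite mulr0 add0r. Qed.

Lemma Re_pii (x : C) : complex.Re (pii R * x) = - (pi * complex.Im x).
Proof. by case: x => a b /=; rewrite mul0r add0r. Qed.

Lemma Im_sum (I : Type) (s : seq I) (F : I -> C) :
  complex.Im (\sum_(i <- s) F i) = \sum_(i <- s) complex.Im (F i).
Proof. exact: (big_morph _ ImD). Qed.

Lemma Im_dotp g (x : 'cV[R]_g) (u : 'cV[C]_g) :
  complex.Im (dotp u (cplx x)) = dotp (map_mx (@complex.Im R) u) x.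
Proof. by rewrite Im_sum; apply: eq_bigr => j _; rewrite !mxE ImMreal. Qed.

Lemma Im_mulmx g (x : 'cV[R]_g) (A : 'M[C]_g) :
  map_mx (@complex.Im R) (A *m cplx x) = map_mx (@complex.Im R) A *m x.
Proof.
apply/colP => j; rewrite !mxE Im_sum.
by apply: eq_bigr => k _; rewrite !mxE ImMreal.
Qed.

(** The linear term is at least -|be| |x|, and completing the square in |x| with coefficient |be| +
    1 leaves one |x| to spare. Gaussian decay is thereby reduced to geometric decay. *)
Lemma quadratic_dominates_abs (al be x : R) : 0 < al ->
  `|x| - (`|be| + 1) ^+ 2 / (4 * al) <= al * x ^+ 2 + be * x.
Proof.
move=> al0; set D := `|be| + 1.
have h : 0 <= al * (`|x| - D / (2 * al)) ^+ 2.
  by rewrite mulr_ge0 ?sqr_ge0 // ltW.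
have e : al * (`|x| - D / (2 * al)) ^+ 2 =
    al * x ^+ 2 - D * `|x| + D ^+ 2 / (4 * al).
  by rewrite -[x ^+ 2]real_normK ?num_real //; field; rewrite gt_eqF.
have : - (`|be| * `|x|) <= be * x.
  by rewrite -normrM lerNl -normrN ler_norm.
by move: h; rewrite e /D; lra.
Qed.

Variables (g : nat) (tau : 'M[C]_g).
Hypothesis htau : siegel tau.

(** The logarithm of the modulus of a term is minus a positive definite quadratic form in k + a,
    plus a linear one. Coercivity decouples the coordinates, and each is then dominated by K_j -
    |k_j|. *)
Lemma theta_term_bounded (a b : 'cV[R]_g) (u : 'cV[C]_g) :
  abs_bounded (theta_term tau a b u).
Proof.
have [_ /posdef_coercive[c c0 hc]] := htau.
pose al := pi * c; have al0 : 0 < al by rewrite mulr_gt0 // pi_gt0.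
pose be j : R := 2 * pi * complex.Im (u j 0).
(* The first summand pays for passing from |k_j + a_j| to |k_j|, the second for the completed
   square. *)
pose K j := `|a j 0| + (`|be j| + 1) ^+ 2 / (4 * al).
have [M hM] := lattice_exp_sum_bounded K.
exists M => s us; apply: le_trans (hM s us); apply: ler_sum => k _.
set x := map_mx intr k + a.
rewrite normc_cexp -expR_sum ler_expR ReD -mulrA mulr_natl mulr2n ReD !Re_pii.
rewrite -/x [dotp (cplx x) _]dotpC !Im_dotp Im_mulmx.
have -> : dotp (map_mx (@complex.Im R) (u + cplx b)) x =
    \sum_j complex.Im (u j 0) * x j 0.
  by apply: eq_bigr => j _; rewrite !mxE ImD /= addr0.
set S := \sum_j _.
have h1 : \sum_j (`|x j 0| - (`|be j| + 1) ^+ 2 / (4 * al)) <=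
    al * dotp x x + 2 * pi * S.
  rewrite 2!big_distrr -big_split /=; apply: ler_sum => j _.
  by rewrite -expr2 mulrA quadratic_dominates_abs.
have h2 : \sum_j - (K j - (absz (k j 0))%:R) <=
    \sum_j (`|x j 0| - (`|be j| + 1) ^+ 2 / (4 * al)).
  apply: ler_sum => j _; rewrite /K.
  suff : ((absz (k j 0))%:R : R) <= `|x j 0| + `|a j 0| by lra.
  rewrite natr_absz intr_norm -[X in `|X|](addrK (a j 0)).
  by apply: le_trans (ler_normB _ _) _; rewrite /x !mxE.
have h3 : al * dotp x x <= pi * dotp (map_mx (@complex.Im R) tau *m x) x.
  by rewrite /al -mulrA ler_wpM2l ?pi_ge0.
by rewrite sumrN in h2; lra.
Qed.

Lemma has_sum_theta (a b : 'cV[R]_g) (u : 'cV[C]_g) :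
  has_sum (theta_term tau a b u) (theta tau a b u).
Proof.
have [l hl] := abs_bounded_has_sum (theta_term_bounded a b u).
by rewrite /theta (has_sumE hl).
Qed.

End ThetaConvergence.

(** * Integer shifts of the characteristics, and reflection *)

Section ThetaSymmetries.
Variables (R : realType) (g : nat).
Local Notation C := R[i].
Variables (tau : 'M[C]_g).
Hypothesis htau : siegel tau.
Implicit Types (a b : 'cV[R]_g) (u : 'cV[C]_g) (n k : 'cV[int]_g).

Lemma cplxD a b : cplx (a + b) = cplx a + cplx b.
Proof. exact: map_mxD. Qed.

Lemma cplxN a : cplx (- a) = - cplx a.
Proof. exact: map_mxN. Qed.

Lemma dotp_cplx a b : dotp (cplx a) (cplx b) = (dotp a b)%:C.
Proof. exact: (dotp_map (real_complex R)). Qed.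

Lemma siegel2 : siegel (2 *: tau).
Proof.
have [tT tpos] := htau; split; first by rewrite linearZ /= tT.
move=> x x0; have -> : map_mx (@complex.Im R) (2 *: tau) =
    2 *: map_mx (@complex.Im R) tau.
  by apply/matrixP => i j; rewrite !mxE !mulr_natl !mulr2n ImD.
by rewrite -scalemxAl dotpZl mulr_gt0 // tpos.
Qed.

Lemma theta_shift_l a b u n :
  theta tau (a + map_mx intr n) b u = theta tau a b u.
Proof.
apply: has_sumE.
have bij : bijective (fun k => k + n).
  by exists (fun k => k - n) => k; rewrite (addrK, subrK).
apply: eq_has_sum (has_sum_reindex bij (has_sum_theta htau a b u)) => k.
by rewrite /= /theta_term map_mxD -addrA [map_mx _ n + _]addrC.
Qed.

(** The new phase splits into <k, n>, an integer that contributes 1, and the constant <a, n>. *)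
Lemma theta_shift_r a b u n :
  theta tau a (b + map_mx intr n) u =
  cexp (2 * pii R * (dotp a (map_mx intr n))%:C) * theta tau a b u.
Proof.
apply: has_sumE.
apply: eq_has_sum (has_sumZ _ (has_sum_theta htau a b u)) => k.
rewrite /theta_term.
set x := cplx (map_mx intr k + a).
rewrite (cplxD b) addrA (dotpDr x (u + _)) mulrDr addrA [in RHS]cexpD mulrC.
congr (_ * _); rewrite dotp_cplx dotpDl (dotp_map intr) rmorphD mulrDr cexpD.
by rewrite /= rmorph_int cexp_2pii_int mul1r.
Qed.

Lemma theta_opp a b u : theta tau (- a) (- b) (- u) = theta tau a b u.
Proof.
apply: has_sumE.
have bij : bijective (fun k => - k) by exists (fun k => - k) => k; rewrite opprK.
apply: eq_has_sum (has_sum_reindex bij (has_sum_theta htau a b u)) => k.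
rewrite /= /theta_term.
have -> : map_mx intr (- k) + a = - (map_mx intr k - a).
  by rewrite map_mxN opprD opprK.
by rewrite !cplxN mulmxN -opprD !dotpNl !dotpNr opprK.
Qed.

End ThetaSymmetries.

(** * The Schroter relations *)

Section Schroter.
Variables (R : realType) (g : nat).
Local Notation C := R[i].

Lemma map_intr_repr2 (p : 'cV['I_2]_g) : map_mx intr (repr2 int p) = repr2 R p.
Proof. by apply/colP => j; rewrite !mxE mulrz_nat. Qed.

Definition lattice_pair (v : 'cV['I_2]_g * ('cV[int]_g * 'cV[int]_g)) :
    'cV[int]_g * 'cV[int]_g :=
  (v.2.1 + v.2.2 + repr2 int v.1, v.2.1 - v.2.2).

(** A pair (k, l) determines k + l = 2m + p and k - l = 2n + p, so p is their common parity and m, n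
    are the floor quotients by 2. *)
Lemma lattice_pair_bij : bijective lattice_pair.
Proof.
pose par (z : int) : 'I_2 := inord (absz (modz z 2)).
have parE z : (par z)%:R = modz z 2 :> int.
  by rewrite inordK; lia.
exists (fun k : 'cV[int]_g * 'cV[int]_g => (\col_j par (k.1 j 0 - k.2 j 0),
  (\col_j divz (k.1 j 0 + k.2 j 0) 2, \col_j divz (k.1 j 0 - k.2 j 0) 2))).
- move=> [p [m n]]; rewrite /lattice_pair /=; congr (_, (_, _)).
  + apply/colP => j; rewrite !mxE; apply: val_inj; rewrite /par /= inordK.
      by have := ltn_ord (p j 0); lia.
    by lia.
  + apply/colP => j; rewrite !mxE; move: (m j 0) (n j 0) => M N.
    by case: (p j 0) => P /=; lia.
  + apply/colP => j; rewrite !mxE; move: (m j 0) (n j 0) => M N.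
    by case: (p j 0) => P /=; lia.
- move=> [k l]; rewrite /lattice_pair /=; congr (_, _);
    by apply/colP => j; rewrite !mxE ?parE; lia.
Qed.

(** If y1, y2 are the shifted lattice points on the right, those on the left are y1 + y2 and y1 -
    y2. The parallelogram law for the quadratic part and its bilinear analogue for the linear part
    separate y1 from y2. *)
Lemma theta_term_mul (tau : 'M[C]_g) a1 a2 b1 b2 u1 u2 p m n :
  theta_term tau a1 b1 u1 (m + n + repr2 int p) *
    theta_term tau a2 b2 u2 (m - n) =
  theta_term (2 *: tau) (2^-1 *: (a1 + a2 + repr2 R p)) (b1 + b2) (u1 + u2) m *
  theta_term (2 *: tau) (2^-1 *: (a1 - a2 + repr2 R p)) (b1 - b2) (u1 - u2) n.
Proof.
rewrite /theta_term.
set y1 := map_mx intr m + _; set y2 := map_mx intr n + _.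
have -> : map_mx intr (m + n + repr2 int p) + a1 = y1 + y2.
  by apply/colP => j; rewrite !mxE !rmorphD /= mulrz_nat; field.
have -> : map_mx intr (m - n) + a2 = y1 - y2.
  by apply/colP => j; rewrite !mxE !rmorphD rmorphN /=; field.
clearbody y1 y2; rewrite -!cexpD !cplxD !cplxN; congr cexp.
rewrite -!scalemxAl !mulmxDr !mulmxN.
by rewrite !(dotpDl, dotpDr, dotpNl, dotpNr, dotpZl, dotpZr); ring.
Qed.

Lemma siegel_schroter (tau : 'M[C]_g) : siegel tau -> schroter tau.
Proof.
move=> ht a1 a2 b1 b2 u1 u2; have ht2 := siegel2 ht.
have := has_sum_prod (theta_term_bounded ht a1 b1 u1)
  (theta_term_bounded ht a2 b2 u2) (has_sum_theta ht a1 b1 u1)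
  (has_sum_theta ht a2 b2 u2).
move=> /(has_sum_reindex lattice_pair_bij) hS.
(* Grouping the pairs by p leaves a finite outer sum, whose terms are products of theta series at 2
   tau. *)
apply: has_sum_fin; apply: has_sum_fubini hS _ => p /=.
under eq_fun => v do rewrite theta_term_mul.
by apply: has_sum_prod;
  [exact: theta_term_bounded|exact: theta_term_bounded
  |exact: has_sum_theta|exact: has_sum_theta].
Qed.

End Schroter.

(** * Vanishing of the Pfaffian of a singular skew matrix *)

Section Pfaffian.
Variables (K : numFieldType) (m : nat) (A : 'M[K]_m).
Implicit Types (f : 'I_m -> 'I_m) (s : 'S_m).

(* The sum defining the Pfaffian, with the labels of rows and columns replaced
   along f. *)
Definition relabeled_pfaffian f : K :=
  \sum_(s : 'S_m) (-1) ^+ s *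
    \prod_(i < m | ~~ odd i) A (f (s i)) (f (s (ordS i))).

(** Composing the permutation with the transposition of j and k flips its sign and changes no entry,
    so the sum equals its own opposite. *)
Lemma relabeled_pfaffian_eq0 f j k :
  j != k -> f j = f k -> relabeled_pfaffian f = 0.
Proof.
move=> jk fjk; set Q := relabeled_pfaffian f.
have ft x : f (tperm j k x) = f x by case: tpermP => [->|->|].
suff QN : Q = - Q.
  have /eqP : Q + Q = 0 by rewrite {1}QN addNr.
  by rewrite -mulr2n mulrn_eq0 /= => /eqP.
rewrite {1}/Q /relabeled_pfaffian (reindex_inj (mulIg (tperm j k))) /= -sumrN.
apply: eq_bigr => s _; rewrite odd_permM odd_tperm jk addbT signrN mulNr.
by congr (- (_ * _)); apply: eq_bigr => i _; rewrite !permM !ft.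
Qed.

(** A Cramer-type argument: choose v_j nonzero and relabel j as k. The sum over k of v_k times the
    relabeled sum vanishes, because for each permutation the label j sits in a single factor, to
    which the kernel equation applies. For k other than j a label is repeated, so only v_j times the
    original sum survives. *)
Lemma pfaffian_kernel_eq0 (v : 'rV[K]_m) :
  v != 0 -> v *m A = 0 -> A *m v^T = 0 -> pfaffian A = 0.
Proof.
move=> v0 vA Av; rewrite /pfaffian; case: ifPn => // m_even.
have /rV0Pn[j vj] := v0.
have [f fE] : exists f : 'I_m -> 'I_m -> 'I_m,
    forall k x, f k x = if x == j then k else x by eexists.
have ordSE (i : 'I_m) : ~~ odd i -> val (ordS i) = i.+1.
  move=> i_even /=; rewrite modn_small //.
  rewrite ltn_neqAle ltn_ord andbT; apply: contraNneq m_even => <- /=.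
  by rewrite i_even.
have Sum0 : \sum_k v 0 k * relabeled_pfaffian (f k) = 0.
  transitivity (\sum_(s : 'S_m) (-1) ^+ s * \sum_k v 0 k *
      \prod_(i < m | ~~ odd i) A (f k (s i)) (f k (s (ordS i)))).
    under eq_bigr => k _ do rewrite big_distrr /=.
    rewrite exchange_big; apply: eq_bigr => s _; rewrite big_distrr.
    by apply: eq_bigr => k _; exact: mulrCA.
  apply: big1 => s _; set i0 := (s^-1 j)%g.
  have fs k x : f k (s x) = if x == i0 then k else s x.
    by rewrite fE -(inj_eq (@perm_inj _ s) x) permKV.
  apply/eqP; rewrite mulf_eq0; apply/orP; right; apply/eqP.
  (* At an odd position j is the second index of its factor and A v = 0 applies; at an even position
     it is the first, and v A = 0 applies. *)
  have [i0_odd|i0_even] := boolP (odd i0).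
  - have i1_lt : (i0.-1 < m)%N by apply: leq_ltn_trans (ltn_ord i0); exact: leq_pred.
    pose i1 := Ordinal i1_lt.
    have i1S : i1.+1 = i0 by rewrite prednK // lt0n; apply: contraTneq i0_odd => ->.
    have i1_even : ~~ odd i1 by move: i0_odd; rewrite -i1S.
    have Si1 : ordS i1 = i0 by apply: val_inj; rewrite ordSE.
    have i10 : i1 != i0 by rewrite -val_eqE /= -i1S neq_ltn ltnSn.
    under eq_bigr => k _.
      rewrite (bigD1 i1) // !fs Si1 eqxx (negbTE i10) mulrA.
      under eq_bigr => i /andP[i_even ii1].
        have ii0 : i != i0 by apply: contraTneq i0_odd => <-.
        have Sii0 : ordS i != i0.
          apply: contra ii1 => /eqP Si; apply/eqP/val_inj.
          by apply/eq_add_S; rewrite -ordSE // Si i1S.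
        by rewrite !fs (negbTE ii0) (negbTE Sii0); over.
      over.
    rewrite -big_distrl /=.
    have /colP/(_ (s i1)) := Av; rewrite !mxE => h.
    rewrite (_ : \sum_k _ = 0) ?mul0r // -[RHS]h.
    by apply: eq_bigr => k _; rewrite mxE mulrC.
  - have Si0 : ordS i0 != i0 by rewrite -val_eqE ordSE //= neq_ltn ltnSn orbT.
    under eq_bigr => k _.
      rewrite (bigD1 i0) // !fs eqxx (negbTE Si0) mulrA.
      under eq_bigr => i /andP[i_even ii0].
        have Sii0 : ordS i != i0.
          apply: contraNneq i0_even => Si; rewrite -Si ordSE //=.
        by rewrite !fs (negbTE ii0) (negbTE Sii0); over.
      over.
    rewrite -big_distrl /=.
    have /rowP/(_ (s (ordS i0))) := vA; rewrite !mxE => h.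
    by rewrite (_ : \sum_k _ = 0) ?mul0r // -[RHS]h.
have h : v 0 j * relabeled_pfaffian (f j) = 0.
  rewrite -[RHS]Sum0 (bigD1 j) //= [X in _ + X]big1 ?addr0 // => k kj.
  by rewrite (@relabeled_pfaffian_eq0 _ j k) ?mulr0 1?eq_sym // !fE eqxx (negbTE kj).
have -> : \sum_(s : 'S_m) (-1) ^+ s * \prod_(i < m | ~~ odd i) A (s i) (s (ordS i))
    = relabeled_pfaffian (f j).
  apply: eq_bigr => s _; congr (_ * _); apply: eq_bigr => i _.
  by rewrite !fE; congr (A _ _); case: eqP.
move/eqP: h; rewrite mulf_eq0 (negbTE vj) => /eqP ->.
by rewrite mulr0.
Qed.

Lemma pfaffian_singular_eq0 : A^T = - A -> \det A = 0 -> pfaffian A = 0.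
Proof.
move=> AT /eqP/det0P[v v0 vA]; apply: (pfaffian_kernel_eq0 v0 vA).
by rewrite -[A]trmxK -trmx_mul AT mulmxN vA oppr0 trmx0.
Qed.

End Pfaffian.

(** * Sums and differences of Whittaker-Watson dual vectors *)

Definition sum_diff (V : zmodType) (x : 'I_4 -> V) (s d s' d' : V) : Prop :=
  [/\ x 0 + x 1 = s, x 0 - x 1 = d, x 2 + x 3 = s' & x 2 - x 3 = d'].

Section WhittakerWatson.
Variables (K : numFieldType) (g : nat) (x : 'I_4 -> 'cV[K]_g).

Lemma ww_dualE k : ww_dual x k = 2^-1 *: (x 0 + x 1 + x 2 + x 3) - x k.
Proof.
rewrite /ww_dual (_ : \sum_l _ = x 0 + x 1 + x 2 + x 3 - 2 *: x k).
  by rewrite scalerBr scalerA mulVf ?scale1r // pnatr_eq0.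
have -> : x 0 + x 1 + x 2 + x 3 = \sum_l x l.
  by rewrite !big_ord_recl big_ord0 addr0 !addrA; do !congr (_ + _); congr x;
    apply: val_inj.
rewrite (bigD1 k) // [in RHS](bigD1 k) //= eqxx expr1 scaleN1r scaler_nat mulr2n.
rewrite opprD addrACA subrr add0r addrC; congr (_ + _).
by apply: eq_bigr => l /negbTE ->; rewrite expr0 scale1r.
Qed.

(** Each dual vector is half the total minus the original one, so dual sums are complementary sums
    and dual differences are opposite differences. *)
Lemma ww_dual_sum_diff : exists s d s' d',
  sum_diff x s d s' d' /\ sum_diff (ww_dual x) s' (- d) s (- d').
Proof.
exists (x 0 + x 1), (x 0 - x 1), (x 2 + x 3), (x 2 - x 3); split; split=> //;
  by apply/colP => j; rewrite !ww_dualE !mxE; field.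
Qed.

End WhittakerWatson.

Lemma prod4 (K : comNzRingType) (F : 'I_4 -> K) :
  \prod_k F k = (F 0 * F 1) * (F 2 * F 3).
Proof.
rewrite !big_ord_recl big_ord0 mulr1 !mulrA.
by do !congr (_ * _); congr F; apply: val_inj.
Qed.

(** * Characters of (Z/2)^g and their orthogonality *)

Section Characters.
Variables (R : realType) (g : nat).
Local Notation C := R[i].
Implicit Types p q r : 'cV['I_2]_g.

Definition chi p q : C := cexp (pii R * dotp (repr2 C p) (repr2 C q)).

Lemma chiE p q : chi p q = \prod_j (-1) ^+ (p j 0%R * q j 0%R)%N.
Proof.
rewrite /chi /dotp big_distrr cexp_sum; apply: eq_bigr => j _.
by rewrite !mxE -natrM -cexp_pii_nat.
Qed.

Lemma chi_sqr p q : chi p q * chi p q = 1.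
Proof.
rewrite chiE -big_split big1 // => j _ /=.
by rewrite -expr2 -exprM muln2 -signr_odd odd_double.
Qed.

Lemma chiN p q : cexp (- pii R * dotp (repr2 C p) (repr2 C q)) = chi p q.
Proof. by rewrite mulNr -[LHS]mulr1 -(chi_sqr p q) mulrA cexpNK mul1r. Qed.

(** The sum over q factors over the coordinates; one where p and r differ gives the factor 1 - 1 =
    0. *)
Lemma sum_chi p r :
  \sum_q chi p q * chi r q = if p == r then 2 ^+ g else 0.
Proof.
pose v (f : {ffun 'I_g -> 'I_2}) : 'cV['I_2]_g := \col_j f j.
have v_bij : bijective v.
  exists (fun q : 'cV['I_2]_g => [ffun j => q j 0]) => f.
    by apply/ffunP => j; rewrite ffunE mxE.
  by apply/colP => j; rewrite mxE ffunE.
rewrite (reindex v) /=; last exact: onW_bij.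
transitivity (\sum_(f : {ffun 'I_g -> 'I_2})
    \prod_j ((-1) ^+ ((p j 0%R + r j 0%R) * f j)%N : C)).
  apply: eq_bigr => f _; rewrite !chiE -big_split /=.
  by apply: eq_bigr => j _; rewrite mxE mulnDl exprD.
rewrite -(bigA_distr_bigA (fun j (t : 'I_2) =>
  (-1) ^+ ((p j 0%R + r j 0%R) * t)%N : C)).
have [<-|pr] := eqVneq p r.
  rewrite -[in RHS](card_ord g) -prodr_const; apply: eq_bigr => j _.
  under eq_bigr => t _ do rewrite addnn -mul2n -mulnA exprM sqrrN expr1n expr1n.
  by rewrite sumr_const card_ord.
have [j pj] : exists j, p j 0 != r j 0.
  apply/existsP; apply: contraNT pr; rewrite negb_exists => /forallP h.
  by apply/eqP/colP => j; apply/eqP; have := h j; rewrite negbK.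
rewrite (bigD1 j) //= !big_ord_recl big_ord0 /= muln0 expr0 muln1 addr0.
have p2 := ltn_ord (p j 0); have r2 := ltn_ord (r j 0).
suff -> : (p j 0%R + r j 0%R = 1)%N by rewrite expr1 subrr mul0r.
move: pj p2 r2; rewrite -val_eqE.
by case: (p j 0) (r j 0) => [P hP] [Q hQ] /=; lia.
Qed.

End Characters.

(** * The Jacobi identities from the Schroter relations *)

Section Jacobi.
Variables (R : realType) (g : nat).
Local Notation C := R[i].
Variables (tau : 'M[C]_g).
Hypothesis htau : siegel tau.
Implicit Types (a b x : 'cV[R]_g) (u : 'cV[C]_g) (p q r s t : 'cV['I_2]_g).

(** The witness is the vector of carries in the addition mod 2. *)
Lemma repr2D p q : exists n : 'cV[int]_g,
  repr2 R p + repr2 R q = repr2 R (p + q) + 2 *: map_mx intr n.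
Proof.
exists (\col_j ((p j 0%R + q j 0%R)./2)%N%:Z); apply/colP => j.
rewrite !mxE /= -[(_ %% _)%N]/((p j 0%R + q j 0%R) %% 2)%N modn2.
rewrite -natrD -{1}(odd_double_half (p j 0%R + q j 0%R)%N) natrD -mul2n natrM.
by [].
Qed.

Lemma dotp_repr2C (p q : 'cV['I_2]_g) :
  dotp (repr2 C p) (repr2 C q) = (dotp (repr2 R p) (repr2 R q))%:C.
Proof.
by rewrite rmorph_sum; apply: eq_bigr => j _; rewrite !mxE rmorphM /= !rmorph_nat.
Qed.

Lemma addr2_char2 p q r : p + q + r + r = p + q.
Proof.
apply/colP => j; rewrite !mxE -[RHS]addr0 -addrA; congr (_ + _).
by case: (r j 0) => -[|[|//]] h; apply: val_inj.
Qed.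

(** The common shape of both factors on the right of (S); t labels a half-lattice class. *)
Definition half_theta x b u t : C :=
  theta (2 *: tau) (2^-1 *: (x + repr2 R t)) b u.

Lemma half_thetaD x b u p t :
  half_theta (x + repr2 R p) b u t = half_theta x b u (p + t).
Proof.
have [n hn] := repr2D p t; rewrite /half_theta.
have -> : 2^-1 *: (x + repr2 R p + repr2 R t) =
    2^-1 *: (x + repr2 R (p + t)) + map_mx intr n.
  have h2 : 2^-1 * 2 = 1 :> R by rewrite mulVf // pnatr_eq0.
  by rewrite -addrA hn addrA scalerDr scalerA h2 scale1r.
exact: theta_shift_l (siegel2 htau) _ _ _ _.
Qed.

(** Reflection turns t/2 into -t/2, which differs from it by the integer vector t. *)
Lemma half_thetaN x b u t : half_theta (- x) (- b) (- u) t = half_theta x b u t.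
Proof.
rewrite /half_theta.
have -> : 2^-1 *: (x + repr2 R t) =
    - (2^-1 *: (- x + repr2 R t)) + map_mx intr (repr2 int t).
  by apply/colP => j; rewrite !mxE mulrz_nat; field.
rewrite (theta_shift_l (siegel2 htau)).
by rewrite -(theta_opp (siegel2 htau) (2^-1 *: _) (- b) (- u)) !opprK.
Qed.

(** The phase of an integer shift, taken at (x + t)/2, splits into a part depending on x and a
    character of t. *)
Lemma half_theta_shift x b u q t :
  half_theta x (b + repr2 R q) u t =
  cexp (pii R * (dotp x (repr2 R q))%:C) * chi R t q * half_theta x b u t.
Proof.
rewrite /half_theta -(map_intr_repr2 R q) (theta_shift_r (siegel2 htau)).
rewrite /chi -cexpD dotp_repr2C -(map_intr_repr2 R q); congr (cexp _ * _).
by rewrite dotpZl dotpDl rmorphM rmorphD /= fmorphV rmorph_nat; field.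
Qed.

Hypothesis hS : schroter tau.

Lemma schroter_half (a1 a2 b1 b2 : 'cV[R]_g) (u1 u2 : 'cV[C]_g) :
  theta tau a1 b1 u1 * theta tau a2 b2 u2 =
  \sum_t half_theta (a1 + a2) (b1 + b2) (u1 + u2) t *
         half_theta (a1 - a2) (b1 - b2) (u1 - u2) t.
Proof. exact: hS. Qed.

(** Equal shifts by p/2 cancel in the difference a1 - a2 and move the sum a1 + a2 by p, which
    translates the class in that factor alone. *)
Lemma schroter_shift_l (a1 a2 b1 b2 : 'cV[R]_g) (u1 u2 : 'cV[C]_g) p :
  theta tau (a1 + 2^-1 *: repr2 R p) b1 u1 *
    theta tau (a2 + 2^-1 *: repr2 R p) b2 u2 =
  \sum_t half_theta (a1 - a2) (b1 - b2) (u1 - u2) t *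
         half_theta (a1 + a2) (b1 + b2) (u1 + u2) (p + t).
Proof.
apply: etrans (schroter_half _ _ _ _ _ _) _.
have -> : a1 + 2^-1 *: repr2 R p - (a2 + 2^-1 *: repr2 R p) = a1 - a2.
  by rewrite opprD addrACA subrr addr0.
have -> : a1 + 2^-1 *: repr2 R p + (a2 + 2^-1 *: repr2 R p) =
    a1 + a2 + repr2 R p.
  by apply/colP => j; rewrite !mxE; field.
by apply: eq_bigr => t _; rewrite half_thetaD; exact: mulrC.
Qed.

(** The prefactors cancel the part of the phase that is independent of t, leaving the character. *)
Lemma schroter_shift_r (a1 a2 b1 b2 : 'cV[R]_g) (u1 u2 : 'cV[C]_g) q :
  cexp (- pii R * (dotp a1 (repr2 R q))%:C) *
    theta tau a1 (b1 + 2^-1 *: repr2 R q) u1 *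
  (cexp (- pii R * (dotp a2 (repr2 R q))%:C) *
    theta tau a2 (b2 + 2^-1 *: repr2 R q) u2) =
  \sum_t chi R t q * (half_theta (a1 + a2) (b1 + b2) (u1 + u2) t *
    half_theta (a1 - a2) (b1 - b2) (u1 - u2) t).
Proof.
rewrite mulrACA -cexpD -mulrDr -rmorphD -dotpDl.
apply: etrans (congr1 _ (schroter_half _ _ _ _ _ _)) _.
have -> : b1 + 2^-1 *: repr2 R q - (b2 + 2^-1 *: repr2 R q) = b1 - b2.
  by rewrite opprD addrACA subrr addr0.
have -> : b1 + 2^-1 *: repr2 R q + (b2 + 2^-1 *: repr2 R q) =
    b1 + b2 + repr2 R q.
  by apply/colP => j; rewrite !mxE; field.
move: (a1 + a2) (a1 - a2) (b1 + b2) (b1 - b2) (u1 + u2) (u1 - u2).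
move=> a a' b b' u u'; rewrite big_distrr; apply: eq_bigr => t _ /=.
rewrite half_theta_shift mulNr; move: (pii R * _) => z.
move: (cexp (- z)) (cexp z) (cexpNK z) => e e' ee'.
by move: (half_theta _ _ _ _) (half_theta _ _ _ _) => *; rewrite !mulrA ee' mul1r.
Qed.

(** The difference factors do not involve p, and reflection makes them invariant under duality. The
    sum factors enter through a correlation over p, in which duality exchanges S and S'. *)
Lemma schroter_jacobi_a : jacobi_a tau.
Proof.
move=> a b u lhs; rewrite /lhs.
have expand (a' b' : 'I_4 -> 'cV[R]_g) (u' : 'I_4 -> 'cV[C]_g)
      (s d s' d' bs bd bs' bd' : 'cV[R]_g) (us ud us' ud' : 'cV[C]_g) :
    sum_diff a' s d s' d' -> sum_diff b' bs bd bs' bd' ->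
    sum_diff u' us ud us' ud' ->
    \sum_p \prod_(k < 4) theta tau (a' k + 2^-1 *: repr2 R p) (b' k) (u' k) =
    \sum_r \sum_t half_theta d bd ud r * half_theta d' bd' ud' t *
      \sum_p half_theta s bs us (p + r) * half_theta s' bs' us' (p + t).
  move=> [<- <- <- <-] [<- <- <- <-] [<- <- <- <-].
  apply: etrans (eq_bigr _ (fun p _ => etrans (prod4 _)
    (congr2 *%R (schroter_shift_l _ _ _ _ _ _ p)
                (schroter_shift_l _ _ _ _ _ _ p)))) _.
  move: (half_theta _ _ _) (half_theta _ _ _) (half_theta _ _ _)
    (half_theta _ _ _) => D S D' S'.
  under eq_bigr => p _ do rewrite big_distrlr /=.
  rewrite exchange_big; apply: eq_bigr => r _.
  rewrite exchange_big; apply: eq_bigr => t _.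
  by rewrite big_distrr; apply: eq_bigr => p _; rewrite mulrACA.
have [s [d [s' [d' [ha ha']]]]] := ww_dual_sum_diff a.
have [bs [bd [bs' [bd' [hb hb']]]]] := ww_dual_sum_diff b.
have [us [ud [us' [ud' [hu hu']]]]] := ww_dual_sum_diff u.
apply: etrans (expand _ _ _ _ _ _ _ _ _ _ _ _ _ _ _ ha hb hu) _.
apply: etrans _ (esym (expand _ _ _ _ _ _ _ _ _ _ _ _ _ _ _ ha' hb' hu')).
apply: eq_bigr => r _; apply: eq_bigr => t _.
apply: (congr2 *%R).
  exact: (esym (congr2 *%R (half_thetaN _ _ _ _) (half_thetaN _ _ _ _))).
move: (half_theta s _ _) (half_theta s' _ _) => S S'.
(* In characteristic 2, translating p by r + t swaps p + r with p + t. *)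
rewrite (reindex_inj (addIr (r + t))); apply: eq_bigr => p _.
rewrite mulrC !addrA addr2_char2; congr (_ * _).
by rewrite addrAC addr2_char2.
Qed.

(** Summing over q first, orthogonality keeps only equal classes r = t in the two pairs; the single
    sum that remains is invariant under duality. *)
Lemma schroter_jacobi_b : jacobi_b tau.
Proof.
move=> a b u lhs; rewrite /lhs.
have expand (a' b' : 'I_4 -> 'cV[R]_g) (u' : 'I_4 -> 'cV[C]_g)
      (s d s' d' bs bd bs' bd' : 'cV[R]_g) (us ud us' ud' : 'cV[C]_g) :
    sum_diff a' s d s' d' -> sum_diff b' bs bd bs' bd' ->
    sum_diff u' us ud us' ud' ->
    \sum_q \prod_(k < 4)
      (cexp (- pii R * (dotp (a' k) (repr2 R q))%:C) *
       theta tau (a' k) (b' k + 2^-1 *: repr2 R q) (u' k)) =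
    2 ^+ g * \sum_t (half_theta s bs us t * half_theta d bd ud t) *
      (half_theta s' bs' us' t * half_theta d' bd' ud' t).
  move=> [<- <- <- <-] [<- <- <- <-] [<- <- <- <-].
  apply: etrans (eq_bigr _ (fun q _ => etrans (prod4 _)
    (congr2 *%R (schroter_shift_r _ _ _ _ _ _ q)
                (schroter_shift_r _ _ _ _ _ _ q)))) _.
  move: (half_theta _ _ _) (half_theta _ _ _) (half_theta _ _ _)
    (half_theta _ _ _) => S D S' D'.
  under eq_bigr => q _.
    rewrite big_distrlr /=.
    under eq_bigr => r _ do under eq_bigr => t _ do rewrite mulrACA.
    over.
  rewrite exchange_big big_distrr; apply: eq_bigr => r _ /=.
  rewrite exchange_big (bigD1 r) //= -big_distrl /= sum_chi eqxx.
  rewrite [X in _ + X]big1 ?addr0 // => t tr.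
  by rewrite -big_distrl /= sum_chi eq_sym (negbTE tr) mul0r.
have [s [d [s' [d' [ha ha']]]]] := ww_dual_sum_diff a.
have [bs [bd [bs' [bd' [hb hb']]]]] := ww_dual_sum_diff b.
have [us [ud [us' [ud' [hu hu']]]]] := ww_dual_sum_diff u.
apply: etrans (expand _ _ _ _ _ _ _ _ _ _ _ _ _ _ _ ha hb hu) _.
apply: etrans _ (esym (expand _ _ _ _ _ _ _ _ _ _ _ _ _ _ _ ha' hb' hu')).
apply: (congr1 (fun z => 2 ^+ g * z)); apply: eq_bigr => t _.
apply: etrans (mulrACA _ _ _ _) (etrans _ (mulrACA _ _ _ _)).
apply: (congr2 *%R); first exact: mulrC.
exact: (esym (congr2 *%R (half_thetaN _ _ _ _) (half_thetaN _ _ _ _))).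
Qed.

End Jacobi.

(** * Riemann's identities by Fourier inversion *)

Section Riemann.
Variables (R : realType) (g : nat).
Local Notation C := R[i].
Variables (tau : 'M[C]_g).
Hypothesis htau : siegel tau.
Implicit Types (a b : 'I_4 -> 'cV[R]_g) (p q : 'cV['I_2]_g).

Lemma repr20 (K : comNzRingType) : repr2 K (0 : 'cV['I_2]_g) = 0.
Proof. by apply/colP => j; rewrite !mxE. Qed.

Lemma sum_chi_l q : \sum_p chi R p q = if q == 0 then 2 ^+ g else 0.
Proof.
rewrite -sum_chi; apply: eq_bigr => p _.
by rewrite /chi dotpC repr20 (dotpC 0) dotp0r mulr0 cexp0 mulr1.
Qed.

(** Fourier inversion on (Z/2)^g, evaluated at 0. *)
Lemma sum_chi_fourier (E : 'cV['I_2]_g -> C) :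
  \sum_p \sum_q chi R p q * E q = 2 ^+ g * E 0.
Proof.
rewrite exchange_big (bigD1 0) //= -big_distrl /= sum_chi_l eqxx.
rewrite big1 ?addr0 // => q q0.
by rewrite -big_distrl /= sum_chi_l (negbTE q0) mul0r.
Qed.

(** Since [chi] squares to 1, a total shift of 3p gives the same sign as p. The total is 3p both for
    the shifts of a (four times p/2, plus p) and for the dual ones (three times p). *)
Lemma prod_phase_shift a (sh : 'I_4 -> 'cV[R]_g) (T : 'I_4 -> C) p q :
  \sum_k sh k = 3 *: repr2 R p ->
  \prod_k (cexp (- pii R * (dotp (a k + sh k) (repr2 R q))%:C) * T k) =
  chi R p q * \prod_k (cexp (- pii R * (dotp (a k) (repr2 R q))%:C) * T k).
Proof.
move=> hsh; have -> : chi R p q =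
    \prod_k cexp (- pii R * (dotp (sh k) (repr2 R q))%:C).
  rewrite -cexp_sum -big_distrr -rmorph_sum /=.
  have -> : \sum_k dotp (sh k) (repr2 R q) = dotp (\sum_k sh k) (repr2 R q).
    by rewrite exchange_big; apply: eq_bigr => j _; rewrite summxE big_distrl.
  rewrite hsh dotpZl rmorphM rmorph_nat /= -dotp_repr2C.
  transitivity (chi R p q * chi R p q * chi R p q).
    by rewrite chi_sqr mul1r.
  rewrite -(chiN R p q) -!cexpD; congr cexp.
  by move: (pii R) (dotp _ _) => *; ring.
rewrite -big_split; apply: eq_bigr => k _ /=.
by rewrite dotpDl rmorphD mulrDr cexpD -mulrA; exact: mulrCA.
Qed.

(* The characteristics are shifted by p/2, and a_1 by a further p, which makes the
   dual characteristics shift by the integer vectors 0, p, p, p. *)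
Lemma jacobi_b_riemann : jacobi_b tau -> riemann tau.
Proof.
move=> hJ a b u.
pose E (q : 'cV['I_2]_g) := \prod_(k < 4)
  (cexp (- pii R * (dotp (ww_dual a k) (repr2 R q))%:C) *
   theta tau (ww_dual a k) (ww_dual b k + 2^-1 *: repr2 R q) (ww_dual u k)).
pose sh (p : 'cV['I_2]_g) (k : 'I_4) : 'cV[R]_g :=
  2^-1 *: repr2 R p + (if k == 0 then repr2 R p else 0).
pose sh' (p : 'cV['I_2]_g) (k : 'I_4) : 'cV[R]_g :=
  if k == 0 then 0 else repr2 R p.
have sumsh p : \sum_k sh p k = 3 *: repr2 R p.
  rewrite !big_ord_recl big_ord0 /sh /=.
  by apply/colP => j; rewrite !mxE; field.
have sumsh' p : \sum_k sh' p k = 3 *: repr2 R p.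
  rewrite !big_ord_recl big_ord0 /sh' /=.
  by apply/colP => j; rewrite !mxE; ring.
have wwsh p k : ww_dual (fun k => a k + sh p k) k = ww_dual a k + sh' p k.
  rewrite !ww_dualE /sh /sh' /=.
  by case: ifP => _; apply/colP => j; rewrite !mxE; field.
have theta_sh p k c v : theta tau (a k + sh p k) c v =
    theta tau (a k + 2^-1 *: repr2 R p) c v.
  rewrite /sh addrA; case: ifP => _; last by rewrite addr0.
  by rewrite -[X in _ + X]map_intr_repr2 theta_shift_l.
have theta_sh' p k c v : theta tau (ww_dual a k + sh' p k) c v =
    theta tau (ww_dual a k) c v.
  rewrite /sh'; case: ifP => _; first by rewrite addr0.
  by rewrite -map_intr_repr2 theta_shift_l.
(* The Jacobi identity at the shifted characteristics: both of its sides acquire the factor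
   [chi p q], and integer shifts drop out of the theta values. *)
have summand p : \sum_q cexp (- pii R * dotp (repr2 C p) (repr2 C q)) *
    \prod_(k < 4) (cexp (- pii R * (dotp (a k) (repr2 R q))%:C) *
      theta tau (a k + 2^-1 *: repr2 R p) (b k + 2^-1 *: repr2 R q) (u k)) =
    \sum_q chi R p q * E q.
  apply: etrans (etrans (hJ (fun k => a k + sh p k) b u) _).
    apply: eq_bigr => q _; rewrite chiN.
    apply: etrans (esym (prod_phase_shift _ _ _ (sumsh p))) _.
    by apply: eq_bigr => k _; rewrite theta_sh.
  apply: eq_bigr => q _; apply: etrans _ (prod_phase_shift _ _ _ (sumsh' p)).
  by apply: eq_bigr => k _; rewrite wwsh theta_sh'.
transitivity ((2 ^+ g)^-1 * \sum_p \sum_q chi R p q * E q); last first.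
  apply: (congr1 (fun z => (2 ^+ g)^-1 * z)); apply: eq_bigr => p _.
  exact: esym (summand p).
rewrite sum_chi_fourier.
rewrite mulrA mulVf ?mul1r ?expf_neq0 ?pnatr_eq0 //.
apply: eq_bigr => k _; rewrite repr20 scaler0 addr0.
by rewrite dotp0r rmorph0 mulr0 cexp0 mul1r.
Qed.

End Riemann.

(** * The Weierstrass identity for odd theta functions *)

Section Weierstrass.
Variables (R : realType) (g : nat).
Local Notation C := R[i].
Variables (tau : 'M[C]_g).
Hypothesis htau : siegel tau.

Lemma half_period_vec (x : 'cV[R]_g) :
  (forall j, x j 0 \in [:: 0; 2^-1]) ->
  exists n : 'cV[int]_g, x = 2^-1 *: map_mx intr n.
Proof.
move=> hx; exists (\col_j (if x j 0 == 0 then 0 else 1)).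
apply/colP => j; rewrite !mxE; have := hx j; rewrite !inE.
by case: eqP => [-> _|_ /= /eqP ->]; rewrite ?mulr0 ?mulr1.
Qed.

(** By reflection, theta at -u is theta at u with characteristics -a, -b. These differ from a, b by
    the integer vectors 2a = n and 2b = m, and the resulting phase is (-1)^<n, m> with <n, m> = 4
    <a, b> odd. *)
Lemma theta_odd (a b : 'cV[R]_g) (u : 'cV[C]_g) :
  odd_half_period a b -> theta tau a b (- u) = - theta tau a b u.
Proof.
move=> [hab not_even].
have [n an] := half_period_vec (fun j => (hab j).1).
have [m bm] := half_period_vec (fun j => (hab j).2).
have dotp_ab : 4 * dotp a b = (dotp n m)%:~R.
  by rewrite an bm dotpZl dotpZr (dotp_map intr); field.
have N_odd : odd (absz (dotp n m)).
  apply: contra_notT not_even => N_even.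
  exists (divz (dotp n m) 2); rewrite dotp_ab -[2]/(2%:~R) -intrM; congr intr.
  by lia.
rewrite -(theta_opp htau) opprK.
have -> : - a = a + map_mx intr (- n).
  by apply/colP => j; rewrite {1 2}an !mxE rmorphN /=; field.
have -> : - b = b + map_mx intr (- m).
  by apply/colP => j; rewrite {1 2}bm !mxE rmorphN /=; field.
rewrite theta_shift_l // theta_shift_r // -mulN1r; congr (_ * _).
have -> : 2 * pii R * (dotp a (map_mx intr (- m)))%:C =
    pii R * (- dotp n m)%:~R.
  rewrite an dotpZl (dotp_map intr) dotpNr rmorphM /= fmorphV rmorph_nat.
  by rewrite rmorph_int; field.
by rewrite cexp_pii_int abszN -signr_odd N_odd.
Qed.

(** At u1 = w_i + w_j and u2 = w_i - w_j with equal characteristics, one factor of (S) depends on 2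
    w_i only and the other on 2 w_j only, which is a matrix factorization with inner dimension
    2^g. *)
Lemma schroter_weierstrass (a b : 'cV[R]_g) :
  schroter tau -> odd_half_period a b -> weierstrass (theta tau a b).
Proof.
move=> hS hodd w; set f := theta tau a b; set M := \matrix_(i, j) _.
apply: pfaffian_singular_eq0.
  apply/matrixP => i j; rewrite !mxE addrC -(opprB (w i)).
  by rewrite /f theta_odd // mulrN.
pose N := #|{: 'cV['I_2]_g}|.
have cardN : N = (2 ^ g)%N by rewrite /N card_mx card_ord muln1.
pose F : 'M[C]_(2 ^ g + 2, N) := \matrix_(i, p)
  theta (2 *: tau) (2^-1 *: (a + a + repr2 R (enum_val p))) (b + b) (w i + w i).
pose G : 'M[C]_(N, 2 ^ g + 2) := \matrix_(p, j)
  theta (2 *: tau) (2^-1 *: (a - a + repr2 R (enum_val p))) (b - b) (w j + w j).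
have MFG : M = F *m G.
  apply/matrixP => i j; rewrite !mxE.
  apply: etrans (hS a a b b (w i + w j) (w i - w j)) _.
  have -> : w i + w j + (w i - w j) = w i + w i by rewrite addrACA subrr addr0.
  have -> : w i + w j - (w i - w j) = w j + w j.
    by rewrite opprB [w i + w j]addrC -addrA [w i + _]addrC subrK.
  rewrite (reindex_onto enum_val enum_rank) => [|p _]; last exact: enum_rankK.
  apply: eq_big => [p|p _]; first by rewrite enum_valK eqxx.
  by rewrite !mxE.
apply/eqP; have [//|detM] := eqVneq (\det M) 0.
(* A nonzero determinant would force rank 2^g + 2, above the inner dimension. *)
have rkM : \rank M = (2 ^ g + 2)%N by apply: mxrank_unit; rewrite unitmxE unitfE.
have := leq_trans (eq_leq (esym rkM)) (eq_leq (congr1 mxrank MFG)).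
move=> /leq_trans/(_ (mulmx_max_rank F G)).
by rewrite cardN addn2 ltnNge leqnSn.
Qed.

End Weierstrass.

Theorem proposition1p1 (R : realType) (g : nat) (tau : 'M[R[i]]_g)
    (htau : siegel tau) :
  (* the Schroter relations (S) *)
  schroter tau /\
  (* (i) *)
  (schroter tau -> jacobi_b tau) /\
  (* (ii) *)
  (schroter tau -> jacobi_a tau) /\
  (* (iii) *)
  ((jacobi_b tau -> riemann tau) /\ (jacobi_a tau -> riemann tau)) /\
  (* (iv) *)
  ((jacobi_b tau <-> jacobi_a tau) /\ (jacobi_a tau <-> riemann tau) /\
   (jacobi_b tau <-> riemann tau)) /\
  (* (v) *)
  (schroter tau ->
   forall a b : 'cV[R]_g, odd_half_period a b -> weierstrass (theta tau a b)).
Proof.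
have hS := siegel_schroter htau.
have hB := schroter_jacobi_b htau hS.
have hA := schroter_jacobi_a htau hS.
have hR := jacobi_b_riemann htau hB.
split; first exact: hS.
split; first exact: schroter_jacobi_b.
split; first exact: schroter_jacobi_a.
split; first by split=> _; exact: hR.
split; first by split; [|split]; split=> _; assumption.
by move=> hS' a b; exact: schroter_weierstrass.
Qed.
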